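(* Let $\delta\in\{1,\tfrac12\}$, let $n$ be a positive integer, and let $z$ be a complex number with $|z|<1$. Then $$\chi_{2n+1}(z)=(-1)^n\,\frac1\delta\,\frac{\pi^{2n+1}}{4(2n)!}\int_0^\delta E_{2n}(t)\,\frac{2z(1+z^2)\sin(\pi t)}{1-2z^2\cos(2\pi t)+z^4}\,dt$$ and $$\chi_{2n}(z)=(-1)^n\,\frac1\delta\,\frac{\pi^{2n}}{4(2n-1)!}\int_0^\delta E_{2n-1}(t)\,\frac{2z(1-z^2)\cos(\pi t)}{1-2z^2\cos(2\pi t)+z^4}\,dt.$$
   Context: The Legendre chi function is $\chi_s(z)=\sum_{k=0}^\infty \frac{z^{2k+1}}{(2k+1)^s}$ for complex $z,s$ with $|z|\le 1$ and $\operatorname{Re}s>1$. The Euler polynomials $E_n(x)$ (of degree $n$ in $x$) are defined by the generating function $$\frac{2e^{tx}}{e^t+1}=\sum_{n=0}^\infty E_n(x)\frac{t^n}{n!}\qquad(|t|<\pi).$$ *)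

(* Defs.v *)
From Stdlib Require Import Reals Factorial.
From Coquelicot Require Import Coquelicot.

Definition cexp (w : C) : C :=
  (exp (Re w) * cos (Im w), exp (Re w) * sin (Im w))%R.

(* [iota] picks the unique sum; it is only meaningful where the series
   converges, in particular for |z| <= 1 and Re s > 1. For complex s,
   (2k+1)^s means exp (s ln (2k+1)) with the real logarithm. *)
Definition legendre_chi (s z : C) : C :=
  @iota C_CompleteNormedModule
    (fun v : C =>
       @is_series C_AbsRing C_NormedModule
         (fun k : nat =>
            (z ^ (2 * k + 1) / cexp (s * RtoC (ln (INR (2 * k + 1)))))%C)
         v).

(* Uniqueness of power series coefficients makes this property determine
   every [E n x], and forces [E n] to be polynomial of degree n in x, so
   polynomiality is not required separately. *)
Definition is_euler_polynomials (E : nat -> R -> R) : Prop :=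
  forall (x : R) (t : C), (Cmod t < PI)%R ->
    @is_series C_AbsRing C_NormedModule
      (fun n : nat => (RtoC (E n x) * (t ^ n / RtoC (INR (fact n))))%C)
      (2 * cexp (t * RtoC x) / (cexp t + 1))%C.

(* Main.v *)
Require Import Defs.
From Stdlib Require Import Reals Factorial Lra Lia.
From Coquelicot Require Import Coquelicot.

(** Write [a n = E n / n!], the Taylor coefficients in [t] of
    [2 exp (t x) / (exp t + 1)].  Comparing power series gives [a 0 = 1], the
    Appell relation [a (n+1)' = a n], the reflection [a n (1 - x) = (-1)^n a n x]
    and [a n (x + 1) + a n x = 2 x^n / n!]
    ([is_derive_taylor_coeff], [taylor_coeff_reflect], [taylor_coeff_add1]).
    Hence [a (2m)] vanishes at [0] and [1] for [m > 0], and [a (2m+1)] vanishes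
    at [1/2].

    Put [w = (2k+1) pi].  Integrating by parts on [[0, delta]], these zeros and
    those of [sin (w t)] at [0] and [1] and of [cos (w t)] at [1/2] kill every
    boundary term except the one coming from [a 0], for both values of [delta].
    So the integral of [a (2n) t * sin (w t)] is
    [(-1)^n 2 delta / w^(2n+1)], and that of [a (2n-1) t * cos (w t)] is
    [(-1)^n 2 delta / w^(2n)] ([is_RInt_taylor_coeff_trig]).

    On the other side, with [u = z exp (i pi t)] and [v = z exp (- i pi t)],
    the two kernels are [u/(1-u^2) -/+ v/(1-v^2)], divided by [i] in the sine
    case.  Expanding both geometric series yields
    [2 sum z^(2k+1) sin ((2k+1) pi t)] and [2 sum z^(2k+1) cos ((2k+1) pi t)],
    with a remainder that is uniform in [t] because [|u| = |v| = |z| < 1]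
    ([sin_kernel_remainder], [cos_kernel_remainder]).  Uniform convergence
    allows termwise integration ([is_series_RInt]), and the resulting series is
    the one defining the Legendre chi function, up to the constant in front. *)

Open Scope R_scope.

(** * Taylor coefficients of the Euler generating function *)

(** The coefficient [E n x / n!] of [t^n] in the generating function.  With this
    normalisation the Appell relation has no numerical factor. *)
Definition taylor_coeff (E : nat -> R -> R) (n : nat) (x : R) : R :=
  E n x / INR (fact n).

Lemma is_series_RtoC_inv (u : nat -> R) (l : R) :
  @is_series C_AbsRing C_NormedModule (fun n => RtoC (u n)) (RtoC l) ->
  is_series u l.
Proof.
  intros H.
  assert (Hs : forall N, sum_n u N =
      fst (@sum_n C_AbelianMonoid (fun n => RtoC (u n)) N)).
  { induction N as [|N IH].
    - rewrite !sum_O. reflexivity.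
    - rewrite !sum_Sn, IH. reflexivity. }
  unfold is_series in *.
  apply filterlim_ext with (fun N =>
      fst (@sum_n C_AbelianMonoid (fun n => RtoC (u n)) N)).
  { intros N. symmetry. apply Hs. }
  eapply filterlim_comp. { apply H. }
  apply (@continuous_fst R_UniformSpace R_UniformSpace l 0).
Qed.

Lemma cexp_RtoC (u : R) : cexp (RtoC u) = RtoC (exp u).
Proof.
  unfold cexp, RtoC; simpl. rewrite cos_0, sin_0.
  apply injective_projections; simpl; ring.
Qed.

(** The defining property restricted to real arguments; this much already
    determines the polynomials. *)
Lemma is_pseries_taylor_coeff (E : nat -> R -> R) (hE : is_euler_polynomials E)
    (x t : R) :
  Rabs t < PI ->
  is_pseries (fun n => taylor_coeff E n x) t (2 * exp (t * x) / (exp t + 1)).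
Proof.
  intros Ht.
  assert (Hpos := exp_pos t).
  assert (Ht' : (Cmod (RtoC t) < PI)%R) by (rewrite Cmod_R; exact Ht).
  assert (H := hE x (RtoC t) Ht').
  apply is_pseries_R, is_series_RtoC_inv.
  rewrite <- RtoC_mult, !cexp_RtoC in H.
  rewrite RtoC_div, RtoC_mult, RtoC_plus by lra.
  eapply is_series_ext; [|exact H].
  intros n. unfold taylor_coeff.
  rewrite <- RtoC_pow, <- RtoC_div, <- RtoC_mult by apply INR_fact_neq_0.
  apply f_equal. field.
  apply INR_fact_neq_0.
Qed.

Lemma CV_radius_ge (a : nat -> R) (x : R) :
  ex_pseries a x -> Rbar_le (Rabs x) (CV_radius a).
Proof.
  intros Hx. apply Rbar_not_lt_le. intros Hlt.
  apply (CV_disk_outside a x Hlt).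
  apply (ex_series_lim_0 (fun n => a n * x ^ n)).
  now apply ex_pseries_R.
Qed.

Lemma pseries_coeff_unique (a b : nat -> R) (f : R -> R) (r : R) :
  0 < r ->
  (forall t, Rabs t < r -> is_pseries a t (f t)) ->
  (forall t, Rabs t < r -> is_pseries b t (f t)) ->
  forall n, a n = b n.
Proof.
  intros Hr Ha Hb n.
  assert (Hh : Rabs (r / 2) < r) by (rewrite Rabs_pos_eq; lra).
  assert (Hrad : forall c, (forall t, Rabs t < r -> is_pseries c t (f t)) ->
             Rbar_lt 0 (CV_radius c)).
  { intros c Hc. eapply Rbar_lt_le_trans; [|apply CV_radius_ge with (x := r / 2)].
    - simpl. rewrite Rabs_pos_eq; lra.
    - eexists. apply Hc, Hh. }
  apply PSeries_ext_recip; auto.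
  exists (mkposreal r Hr). intros t Ht.
  assert (Ht' : Rabs t < r).
  { revert Ht. unfold ball; simpl. unfold AbsRing_ball, abs, minus, plus, opp; simpl.
    now rewrite Ropp_0, Rplus_0_r. }
  now rewrite (is_pseries_unique _ _ _ (Ha t Ht')), (is_pseries_unique _ _ _ (Hb t Ht')).
Qed.

Lemma is_pseries_exp_mul (x t : R) :
  is_pseries (fun n => x ^ n / INR (fact n)) t (exp (t * x)).
Proof.
  apply is_pseries_R. generalize (proj1 (is_pseries_R _ _ _) (is_exp_Reals (t * x))).
  apply is_series_ext. intros n. rewrite Rpow_mult_distr. simpl. unfold Rdiv; ring.
Qed.

Lemma taylor_coeff_0 (E : nat -> R -> R) (hE : is_euler_polynomials E) x :
  taylor_coeff E 0%nat x = 1.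
Proof.
  assert (H0 : Rabs 0 < PI) by (rewrite Rabs_R0; apply PI_RGT_0).
  assert (H := is_pseries_unique _ _ _ (is_pseries_taylor_coeff E hE x 0 H0)).
  rewrite PSeries_0, Rmult_0_l, exp_0 in H. rewrite H. field.
Qed.

(** Replacing [t] by [-t] in the generating function is the same as replacing
    [x] by [1 - x]. *)
Lemma taylor_coeff_reflect (E : nat -> R -> R) (hE : is_euler_polynomials E) n x :
  taylor_coeff E n (1 - x) = (-1) ^ n * taylor_coeff E n x.
Proof.
  revert n.
  apply (pseries_coeff_unique _ _ (fun t => 2 * exp (t * (1 - x)) / (exp t + 1)) PI).
  - apply PI_RGT_0.
  - intros t Ht. now apply is_pseries_taylor_coeff.
  - intros t Ht.
    replace (2 * exp (t * (1 - x)) / (exp t + 1))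
      with (2 * exp (- t * x) / (exp (- t) + 1)).
    + assert (Ht' : Rabs (- t) < PI) by now rewrite Rabs_Ropp.
      apply is_pseries_R.
      generalize (proj1 (is_pseries_R _ _ _) (is_pseries_taylor_coeff E hE x (- t) Ht')).
      apply is_series_ext. intros n.
      replace (- t) with (-1 * t) by ring. rewrite Rpow_mult_distr. simpl. ring.
    + replace (t * (1 - x)) with (t + (- t * x)) by ring.
      rewrite exp_plus, exp_Ropp. assert (Hpos := exp_pos t). field. lra.
Qed.

Lemma taylor_coeff_add1 (E : nat -> R -> R) (hE : is_euler_polynomials E) n x :
  taylor_coeff E n (x + 1) + taylor_coeff E n x = 2 * (x ^ n / INR (fact n)).
Proof.
  revert n.
  apply (pseries_coeff_unique _ _ (fun t => 2 * exp (t * x)) PI).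
  - apply PI_RGT_0.
  - intros t Ht.
    replace (2 * exp (t * x)) with
      (2 * exp (t * (x + 1)) / (exp t + 1) + 2 * exp (t * x) / (exp t + 1)).
    + apply (is_pseries_plus (fun n => taylor_coeff E n (x + 1))
        (fun n => taylor_coeff E n x)); now apply is_pseries_taylor_coeff.
    + rewrite Rmult_plus_distr_l, Rmult_1_r, exp_plus.
      assert (Hpos := exp_pos t). field. lra.
  - intros t Ht.
    apply (is_pseries_scal 2 (fun n => x ^ n / INR (fact n))).
    + apply Rmult_comm.
    + apply is_pseries_exp_mul.
Qed.

(** The generating function at [x] is the one at [0] times [exp (t x)]; the right
    side is the coefficient of [t^n] in the Cauchy product.  In particular
    [E n] is a polynomial in [x]. *)
Lemma taylor_coeff_expand (E : nat -> R -> R) (hE : is_euler_polynomials E) n x :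
  taylor_coeff E n x =
    sum_n (fun k => taylor_coeff E k 0 * (x ^ (n - k) / INR (fact (n - k)))) n.
Proof.
  rewrite sum_n_Reals.
  change (taylor_coeff E n x =
    PS_mult (fun k => taylor_coeff E k 0) (fun k => x ^ k / INR (fact k)) n).
  revert n.
  apply (pseries_coeff_unique _ _ (fun t => 2 * exp (t * x) / (exp t + 1)) PI).
  - apply PI_RGT_0.
  - intros t Ht. now apply is_pseries_taylor_coeff.
  - intros t Ht.
    replace (2 * exp (t * x) / (exp t + 1)) with
      (2 * exp (t * 0) / (exp t + 1) * exp (t * x))
      by (rewrite Rmult_0_r, exp_0; field; assert (Hpos := exp_pos t); lra).
    set (s := (Rabs t + PI) / 2).
    assert (Hs : 0 <= s) by (unfold s; assert (H := Rabs_pos t); lra).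
    apply is_pseries_mult.
    + now apply is_pseries_taylor_coeff.
    + apply is_pseries_exp_mul.
    + eapply Rbar_lt_le_trans; [|apply CV_radius_ge with (x := s)].
      * rewrite (Rabs_pos_eq s) by lra. simpl. unfold s; lra.
      * eexists. apply is_pseries_taylor_coeff; auto.
        rewrite Rabs_pos_eq by lra. unfold s; lra.
    + eapply Rbar_lt_le_trans; [|apply CV_radius_ge with (x := s)].
      * rewrite (Rabs_pos_eq s) by lra. simpl. unfold s; lra.
      * eexists. apply is_pseries_exp_mul.
Qed.

(** The Appell relation [E (n+1)' = (n+1) E n], freed of its factor. *)
Lemma is_derive_taylor_coeff (E : nat -> R -> R) (hE : is_euler_polynomials E) n x :
  is_derive (taylor_coeff E (S n)) x (taylor_coeff E n x).
Proof.
  apply (is_derive_ext (fun y => sum_n (fun k => taylor_coeff E k 0 *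
      (y ^ (S n - k) / INR (fact (S n - k)))) (S n))).
  { intros y. symmetry. apply (taylor_coeff_expand E hE). }
  rewrite (taylor_coeff_expand E hE).
  (* The extra term [k = n + 1] is constant in [x], so its derivative is the
     zero added here. *)
  replace (sum_n (fun k => taylor_coeff E k 0 * (x ^ (n - k) / INR (fact (n - k)))) n)
    with (sum_n (fun k => if (k <=? n)%nat then
                   taylor_coeff E k 0 * (x ^ (n - k) / INR (fact (n - k))) else 0) (S n)).
  - apply (is_derive_sum_n (K := R_AbsRing) (V := R_NormedModule)
      (fun k y => taylor_coeff E k 0 * (y ^ (S n - k) / INR (fact (S n - k))))).
    intros k Hk.
    destruct (Nat.leb_spec k n) as [Hkn|Hkn].
    + rewrite Nat.sub_succ_l by exact Hkn.
      set (m := (n - k)%nat). rewrite fact_simpl, mult_INR, S_INR.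
      auto_derive; [exact I|]. change (pred (S m)) with m.
      assert (Hf := INR_fact_neq_0 m). assert (Hm := pos_INR m).
      change (match m with 0%nat => 1 | S _ => INR m + 1 end) with (INR (S m)).
      rewrite S_INR. field. split; [assumption|lra].
    + replace (S n - k)%nat with 0%nat by lia.
      auto_derive; [exact I|simpl; ring].
  - rewrite sum_Sn. replace (S n <=? n)%nat with false
      by (symmetry; apply Nat.leb_gt; lia).
    change (@plus R_AbelianMonoid) with Rplus. rewrite Rplus_0_r.
    apply sum_n_ext_loc. intros k Hk.
    now rewrite (proj2 (Nat.leb_le k n) Hk).
Qed.

Lemma continuous_taylor_coeff (E : nat -> R -> R) (hE : is_euler_polynomials E) n x :
  continuous (taylor_coeff E n) x.
Proof.
  destruct n as [|n].
  - apply continuous_ext with (fun _ => 1); [|apply continuous_const].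
    intros y. symmetry. apply (taylor_coeff_0 E hE).
  - apply (ex_derive_continuous (taylor_coeff E (S n))). eexists.
    apply (is_derive_taylor_coeff E hE).
Qed.

Lemma taylor_coeff_even_0 (E : nat -> R -> R) (hE : is_euler_polynomials E) m :
  taylor_coeff E (2 * S m) 0 = 0 /\ taylor_coeff E (2 * S m) 1 = 0.
Proof.
  assert (H1 := taylor_coeff_add1 E hE (2 * S m) 0).
  assert (H2 := taylor_coeff_reflect E hE (2 * S m) 0).
  rewrite pow_1_even in H2. rewrite pow_i in H1 by lia.
  replace (0 + 1) with 1 in H1 by ring. replace (1 - 0) with 1 in H2 by ring.
  lra.
Qed.

Lemma taylor_coeff_odd_half (E : nat -> R -> R) (hE : is_euler_polynomials E) m :
  taylor_coeff E (2 * m + 1) (1 / 2) = 0.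
Proof.
  assert (H2 := taylor_coeff_reflect E hE (2 * m + 1) (1 / 2)).
  replace (2 * m + 1)%nat with (S (2 * m)) in * by lia.
  rewrite pow_1_odd in H2. replace (1 - 1 / 2) with (1 / 2) in H2 by field.
  lra.
Qed.

(** * Integration by parts against the odd harmonics *)

Lemma is_RInt_mul_sin (a b : R -> R) (w d l : R) :
  w <> 0 ->
  (forall t, is_derive a t (b t)) -> (forall t, continuous a t) ->
  (forall t, continuous b t) ->
  is_RInt (fun t => b t * cos (w * t)) 0 d l ->
  is_RInt (fun t => a t * sin (w * t)) 0 d
    ((a 0 - a d * cos (w * d) + l) / w).
Proof.
  intros Hw Hab Ha Hb Hl.
  assert (Hc : forall t, continuous (fun t => cos (w * t)) t)
    by (intros t; apply (ex_derive_continuous (fun t => cos (w * t))); auto_derive; exact I).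
  assert (Hs : forall t, continuous (fun t => sin (w * t)) t)
    by (intros t; apply (ex_derive_continuous (fun t => sin (w * t))); auto_derive; exact I).
  assert (H1 : is_RInt (fun t => w * (a t * sin (w * t)) - b t * cos (w * t)) 0 d
      (- (a d * cos (w * d)) - - (a 0 * cos (w * 0)))).
  { apply (is_RInt_derive (fun t => - (a t * cos (w * t)))).
    - intros t _. evar_last.
      + apply (is_derive_opp (fun t => a t * cos (w * t))).
        apply (is_derive_mult a (fun t => cos (w * t))); [apply Hab| |exact Rmult_comm].
        auto_derive; [exact I|reflexivity].
      + unfold opp, plus, mult; simpl. ring.
    - intros t _. apply (continuous_minus (V := R_NormedModule)).
      + apply (continuous_scal_r w (fun t => a t * sin (w * t))).
        apply (continuous_mult (K := R_AbsRing)); auto.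
      + apply (continuous_mult (K := R_AbsRing)); auto. }
  assert (H2 := is_RInt_scal _ _ _ (/ w) _ (is_RInt_plus _ _ _ _ _ _ H1 Hl)).
  evar_last.
  - eapply is_RInt_ext; [|exact H2].
    intros t _. unfold scal, plus; simpl; unfold mult; simpl. field. exact Hw.
  - unfold scal, plus; simpl; unfold mult; simpl.
    rewrite Rmult_0_r, cos_0. field. exact Hw.
Qed.

Lemma is_RInt_mul_cos (a b : R -> R) (w d l : R) :
  w <> 0 ->
  (forall t, is_derive a t (b t)) -> (forall t, continuous a t) ->
  (forall t, continuous b t) ->
  is_RInt (fun t => b t * sin (w * t)) 0 d l ->
  is_RInt (fun t => a t * cos (w * t)) 0 d ((a d * sin (w * d) - l) / w).
Proof.
  intros Hw Hab Ha Hb Hl.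
  assert (Hc : forall t, continuous (fun t => cos (w * t)) t)
    by (intros t; apply (ex_derive_continuous (fun t => cos (w * t))); auto_derive; exact I).
  assert (Hs : forall t, continuous (fun t => sin (w * t)) t)
    by (intros t; apply (ex_derive_continuous (fun t => sin (w * t))); auto_derive; exact I).
  assert (H1 : is_RInt (fun t => w * (a t * cos (w * t)) + b t * sin (w * t)) 0 d
      (a d * sin (w * d) - a 0 * sin (w * 0))).
  { apply (is_RInt_derive (fun t => a t * sin (w * t))).
    - intros t _. evar_last.
      + apply (is_derive_mult a (fun t => sin (w * t))); [apply Hab| |exact Rmult_comm].
        auto_derive; [exact I|reflexivity].
      + unfold plus, mult; simpl. ring.
    - intros t _. apply (continuous_plus (V := R_NormedModule)).
      + apply (continuous_scal_r w (fun t => a t * cos (w * t))).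
        apply (continuous_mult (K := R_AbsRing)); auto.
      + apply (continuous_mult (K := R_AbsRing)); auto. }
  assert (H2 := is_RInt_scal _ _ _ (/ w) _ (is_RInt_minus _ _ _ _ _ _ H1 Hl)).
  evar_last.
  - eapply is_RInt_ext; [|exact H2].
    intros t _. unfold scal, minus, plus, opp; simpl; unfold mult; simpl. field. exact Hw.
  - unfold scal, minus, plus, opp; simpl; unfold mult; simpl.
    rewrite Rmult_0_r, sin_0. field. exact Hw.
Qed.

(** The angular frequency [(2k+1) pi] of the [k]-th odd harmonic. *)
Definition freq (k : nat) : R := INR (2 * k + 1) * PI.

Lemma freq_neq_0 k : freq k <> 0.
Proof.
  unfold freq. apply Rmult_integral_contrapositive_currified.
  - apply not_0_INR. lia.
  - apply PI_neq0.
Qed.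

Lemma freq_eq k : freq k = PI + 2 * INR k * PI.
Proof. unfold freq. rewrite plus_INR, mult_INR. simpl. ring. Qed.

Lemma cos_freq k : cos (freq k) = -1.
Proof. rewrite freq_eq, cos_period. apply cos_PI. Qed.

Lemma sin_freq k : sin (freq k) = 0.
Proof. rewrite freq_eq, sin_period. apply sin_PI. Qed.

Lemma cos_freq_half k : cos (freq k * (1 / 2)) = 0.
Proof.
  apply cos_eq_0_1. exists (Z.of_nat k). rewrite <- INR_IZR_INZ, freq_eq. field.
Qed.

(** The two integrals are computed by a joint induction on [m]: the cosine
    integral reduces to the sine integral of the same [m], and the sine integral
    for [m + 1] to the cosine integral for [m]. *)
Lemma is_RInt_taylor_coeff_trig (E : nat -> R -> R)
    (hE : is_euler_polynomials E) (delta : R) (k m : nat) :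
  delta = 1 \/ delta = 1 / 2 ->
  is_RInt (fun t => taylor_coeff E (2 * m) t * sin (freq k * t)) 0 delta
    ((-1) ^ m * (2 * delta) / freq k ^ (2 * m + 1)) /\
  is_RInt (fun t => taylor_coeff E (2 * m + 1) t * cos (freq k * t)) 0 delta
    ((-1) ^ (S m) * (2 * delta) / freq k ^ (2 * m + 2)).
Proof.
  intros Hd.
  assert (Hw := freq_neq_0 k).
  assert (Hder := is_derive_taylor_coeff E hE).
  assert (Hcont := continuous_taylor_coeff E hE).
  (* At [delta = 1] the boundary term vanishes because of the sine, and at
     [delta = 1/2] because of the polynomial. *)
  assert (Hcos : forall m,
    is_RInt (fun t => taylor_coeff E (2 * m) t * sin (freq k * t)) 0 delta
      ((-1) ^ m * (2 * delta) / freq k ^ (2 * m + 1)) ->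
    is_RInt (fun t => taylor_coeff E (2 * m + 1) t * cos (freq k * t)) 0 delta
      ((-1) ^ (S m) * (2 * delta) / freq k ^ (2 * m + 2))).
  { intros j Hj. evar_last.
    - apply (is_RInt_mul_cos _ (taylor_coeff E (2 * j)) _ _ _ Hw) with (4 := Hj).
      + rewrite Nat.add_1_r. apply Hder.
      + apply Hcont.
      + apply Hcont.
    - assert (Hb : taylor_coeff E (2 * j + 1) delta * sin (freq k * delta) = 0).
      { destruct Hd as [->| ->].
        - rewrite (Rmult_1_r (freq k)), sin_freq. ring.
        - rewrite (taylor_coeff_odd_half E hE). ring. }
      rewrite Hb. replace (2 * j + 2)%nat with (S (2 * j + 1)) by lia.
      assert (Hp := pow_nonzero _ (2 * j + 1) Hw).
      change (freq k ^ S (2 * j + 1)) with (freq k * freq k ^ (2 * j + 1)).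
      change ((-1) ^ S j) with (-1 * (-1) ^ j). field. split; assumption. }
  enough (Hsin : is_RInt (fun t => taylor_coeff E (2 * m) t * sin (freq k * t)) 0 delta
    ((-1) ^ m * (2 * delta) / freq k ^ (2 * m + 1))) by auto.
  induction m as [|m IH].
  - evar_last.
    + apply (is_RInt_mul_sin _ (fun _ => 0) _ _ 0 Hw).
      * intros t. apply (is_derive_ext (fun _ => 1)).
        -- intros y. symmetry. apply (taylor_coeff_0 E hE).
        -- apply (is_derive_const (K := R_AbsRing) (V := R_NormedModule)).
      * apply Hcont.
      * intros t. apply continuous_const.
      * apply (is_RInt_ext (fun _ => 0)). { intros t _. symmetry. apply Rmult_0_l. }
        evar_last; [apply (is_RInt_const (V := R_NormedModule))|].
        unfold scal; simpl; unfold mult; simpl. ring.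
    + change (2 * 0)%nat with 0%nat. rewrite !(taylor_coeff_0 E hE).
      replace (1 * cos (freq k * delta)) with (1 - 2 * delta).
      * simpl. field. exact Hw.
      * destruct Hd as [->| ->].
        -- rewrite (Rmult_1_r (freq k)), cos_freq. ring.
        -- rewrite cos_freq_half. field.
  - evar_last.
    + apply (is_RInt_mul_sin _ (taylor_coeff E (2 * m + 1)) _ _ _ Hw)
        with (4 := Hcos m IH).
      * replace (2 * S m)%nat with (S (2 * m + 1)) by lia. apply Hder.
      * apply Hcont.
      * apply Hcont.
    + destruct (taylor_coeff_even_0 E hE m) as [H0 H1].
      (* Here the roles are exchanged: the polynomial vanishes at [1], and the
         cosine at [1/2]. *)
      assert (Hb : taylor_coeff E (2 * S m) delta * cos (freq k * delta) = 0).
      { destruct Hd as [->| ->].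
        - rewrite H1. ring.
        - rewrite cos_freq_half. ring. }
      rewrite Hb, H0. replace (2 * S m + 1)%nat with (S (2 * m + 2)) by lia.
      assert (Hp := pow_nonzero _ (2 * m + 2) Hw).
      change (freq k ^ S (2 * m + 2)) with (freq k * freq k ^ (2 * m + 2)).
      field. split; assumption.
Qed.

(** * Termwise integration *)

Lemma is_RInt_Cscal (f : R -> R) (a b l : R) (c : C) :
  is_RInt f a b l ->
  @is_RInt C_R_NormedModule (fun t => (c * RtoC (f t))%C) a b (c * RtoC l)%C.
Proof.
  intros H. destruct c as [c1 c2].
  replace ((c1, c2) * RtoC l)%C with ((c1 * l, c2 * l) : C)
    by (unfold RtoC, Cmult; simpl; f_equal; ring).
  apply (is_RInt_ext (V := C_R_NormedModule) (fun t => (c1 * f t, c2 * f t) : C)).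
  { intros t _. unfold RtoC, Cmult; simpl; f_equal; ring. }
  apply (is_RInt_fct_extend_pair (U := R_NormedModule) (V := R_NormedModule)).
  - apply (is_RInt_scal _ _ _ c1 _ H).
  - apply (is_RInt_scal _ _ _ c2 _ H).
Qed.

Lemma is_RInt_sum_n {V : NormedModule R_AbsRing} (f : nat -> R -> V)
    (a b : R) (l : nat -> V) (n : nat) :
  (forall k, is_RInt (f k) a b (l k)) ->
  is_RInt (fun t => sum_n (fun k => f k t) n) a b (sum_n l n).
Proof.
  intros H. induction n as [|n IH].
  - rewrite sum_O. eapply is_RInt_ext; [|apply H].
    intros t _. now rewrite sum_O.
  - rewrite sum_Sn. eapply is_RInt_ext; [|exact (is_RInt_plus _ _ _ _ _ _ IH (H (S n)))].
    intros t _. now rewrite sum_Sn.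
Qed.

Lemma Csum_n_mult_l (u : C) (f : nat -> C) n :
  sum_n (fun k => (u * f k)%C) n = (u * sum_n f n)%C.
Proof. apply (sum_n_mult_l (K := C_Ring)). Qed.

(** A series [sum c k * w k t] that converges to [F t] uniformly in [t] may be
    integrated term by term over [[0, d]] against a continuous real weight [e].
    Integrability of [F] is not assumed: [e * F] is integrable as a uniform limit
    of integrable functions. *)
Lemma is_series_RInt (e : R -> R) (d : R) (c : nat -> C) (w : nat -> R -> R)
    (l : nat -> R) (F : R -> C) (eps : nat -> R) :
  0 <= d ->
  (forall t, continuous e t) ->
  (forall k, is_RInt (fun t => e t * w k t) 0 d (l k)) ->
  (forall n t, Cmod (F t - sum_n (fun k => c k * RtoC (w k t))%C n) <= eps n) ->
  is_lim_seq eps 0 ->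
  @is_series C_AbsRing C_NormedModule (fun k => c k * RtoC (l k))%C
    (@RInt C_R_CompleteNormedModule (fun t => RtoC (e t) * F t)%C 0 d).
Proof.
  intros Hd He Hl HF Heps.
  destruct (bounded_continuity (V := R_NormedModule) e 0 d) as [M HM].
  { intros t _. apply He. }
  (* [filterlim_RInt] asks for uniform convergence on the whole line, where [e]
     need not be bounded.  Composing [e] with the projection [p] onto [[0, d]]
     makes it bounded without changing the integrals. *)
  set (p := fun t => Rmax 0 (Rmin t d)).
  assert (Hp : forall t, 0 <= p t <= d).
  { intros t. unfold p. split; [apply Rmax_l|].
    apply Rmax_lub; [exact Hd|apply Rmin_r]. }
  assert (Hpt : forall t, Rmin 0 d < t < Rmax 0 d -> p t = t).
  { intros t. rewrite Rmin_left, Rmax_right by exact Hd. intros Ht.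
    unfold p. rewrite Rmin_left, Rmax_right; lra. }
  assert (HM0 : 0 < M).
  { apply Rle_lt_trans with (norm (e 0)); [apply norm_ge_0|apply HM; lra]. }
  set (f := fun n t => (RtoC (e (p t)) * sum_n (fun k => c k * RtoC (w k t)) n)%C).
  destruct (filterlim_RInt (V := C_R_CompleteNormedModule) f 0 d eventually _
      (fun t => RtoC (e (p t)) * F t)%C
      (fun n => sum_n (fun k => c k * RtoC (l k))%C n)) as [If [HIf1 HIf2]].
  - intros n.
    apply (is_RInt_ext (V := C_R_NormedModule)
      (fun t => @sum_n C_AbelianMonoid (fun k => c k * RtoC (e t * w k t))%C n)).
    + intros t Ht. unfold f. rewrite Hpt by exact Ht.
      rewrite <- Csum_n_mult_l. apply (sum_n_ext (G := C_AbelianMonoid)). intros k.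
      rewrite RtoC_mult.
      match goal with |- ?x = ?y => change (@eq C x y) end. ring.
    + exact (is_RInt_sum_n (V := C_R_NormedModule)
        (fun k t => (c k * RtoC (e t * w k t))%C) 0 d (fun k => (c k * RtoC (l k))%C) n
        (fun k => is_RInt_Cscal _ _ _ _ (c k) (Hl k))).
  - apply filterlim_locally. intros r.
    assert (Hr : 0 < r / M) by (apply Rdiv_lt_0_compat; [apply cond_pos|exact HM0]).
    assert (H := proj1 (filterlim_locally eps 0) Heps (mkposreal _ Hr)).
    revert H. apply filter_imp. intros n Hn t.
    apply (C_NormedModule_mixin_compat1 _ (f n t)).
    change (Cmod (f n t - RtoC (e (p t)) * F t)%C < r). unfold f.
    replace (RtoC (e (p t)) * sum_n (fun k => c k * RtoC (w k t)) n
        - RtoC (e (p t)) * F t)%C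
      with (RtoC (e (p t)) * - (F t - sum_n (fun k => c k * RtoC (w k t))%C n))%C
      by ring.
    rewrite Cmod_mult, Cmod_opp, Cmod_R.
    assert (HMt : Rabs (e (p t)) < M) by (apply HM, Hp).
    assert (Hn' : eps n < r / M).
    { revert Hn. unfold ball; simpl. unfold AbsRing_ball, abs, minus, plus, opp; simpl.
      rewrite Ropp_0, Rplus_0_r. apply Rle_lt_trans, Rle_abs. }
    apply Rle_lt_trans with (M * eps n).
    + apply Rmult_le_compat; [apply Rabs_pos|apply Cmod_ge_0|lra|apply HF].
    + apply Rlt_le_trans with (M * (r / M)); [now apply Rmult_lt_compat_l|].
      right. field. lra.
  - assert (HI : @RInt C_R_CompleteNormedModule (fun t => RtoC (e t) * F t)%C 0 d = If).
    { apply (is_RInt_unique (V := C_R_CompleteNormedModule)).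
      eapply (is_RInt_ext (V := C_R_NormedModule)); [|exact HIf2].
      intros t Ht. cbv beta. now rewrite Hpt. }
    rewrite HI. exact HIf1.
Qed.

(** * Expansion of the kernels *)

(** [exp (i x)], given by its real and imaginary parts. *)
Definition cis (x : R) : C := (cos x, sin x).

Lemma cis_pow x n : (cis x ^ n)%C = cis (INR n * x).
Proof.
  induction n as [|n IH].
  - simpl. rewrite Rmult_0_l. unfold cis. now rewrite cos_0, sin_0.
  - rewrite Cpow_S, IH, S_INR, Rmult_plus_distr_r, Rmult_1_l, Rplus_comm.
    unfold cis, Cmult; simpl.
    now rewrite cos_plus, sin_plus, (Rplus_comm (sin x * _)), (Rplus_comm (cos x * sin _)).
Qed.

Lemma Cmod_cis x : Cmod (cis x) = 1.
Proof.
  unfold Cmod, cis; simpl. rewrite !Rmult_1_r.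
  rewrite Rplus_comm. change (cos x * cos x) with (Rsqr (cos x)).
  change (sin x * sin x) with (Rsqr (sin x)). now rewrite sin2_cos2, sqrt_1.
Qed.

Lemma cis_plus_opp x : (cis x + cis (- x))%C = RtoC (2 * cos x).
Proof.
  unfold cis, Cplus, RtoC; simpl. rewrite cos_neg, sin_neg. f_equal; ring.
Qed.

Lemma cis_minus_opp x : (cis x - cis (- x))%C = (Ci * RtoC (2 * sin x))%C.
Proof.
  unfold cis, Cminus, Cplus, Cmult, Copp, Ci, RtoC; simpl.
  rewrite cos_neg, sin_neg. f_equal; ring.
Qed.

Lemma cis_mult_opp x : (cis x * cis (- x))%C = 1%C.
Proof.
  assert (H := sin2_cos2 x). unfold Rsqr in H.
  unfold cis, Cmult, RtoC; simpl. rewrite cos_neg, sin_neg.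
  f_equal; [|ring]. rewrite <- H. ring.
Qed.

Lemma one_minus_sqr_neq_0 (u : C) : Cmod u < 1 -> (1 - u ^ 2)%C <> 0%C.
Proof.
  intros Hu H0.
  assert (H1 : (u ^ 2)%C = 1%C).
  { replace (u ^ 2)%C with (1 - (1 - u ^ 2))%C by ring. rewrite H0. ring. }
  assert (H2 := f_equal Cmod H1). rewrite Cmod_pow, Cmod_1 in H2.
  assert (H3 := Cmod_ge_0 u). nra.
Qed.

Lemma Cmod_one_minus_sqr (u : C) : 1 - Cmod u ^ 2 <= Cmod (1 - u ^ 2)%C.
Proof.
  assert (H := Cmod_triangle (1 - u ^ 2)%C (u ^ 2)%C).
  replace (1 - u ^ 2 + u ^ 2)%C with (RtoC 1) in H by ring.
  rewrite Cmod_1, Cmod_pow in H. lra.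
Qed.

Lemma odd_geometric_sum (u : C) (n : nat) :
  Cmod u < 1 ->
  (u / (1 - u ^ 2) - @sum_n C_AbelianMonoid (fun k => u ^ (2 * k + 1)) n)%C
  = (u ^ (2 * n + 3) / (1 - u ^ 2))%C.
Proof.
  intros Hu. assert (H0 := one_minus_sqr_neq_0 u Hu).
  induction n as [|n IH].
  - rewrite sum_O. simpl (2 * 0 + 1)%nat. simpl (2 * 0 + 3)%nat. field. exact H0.
  - rewrite sum_Sn.
    change (@plus C_AbelianMonoid) with Cplus.
    match goal with |- (?a - (?s + ?b))%C = _ =>
      replace (a - (s + b))%C with ((a - s) - b)%C by ring end.
    rewrite IH.
    replace (2 * S n + 1)%nat with (2 * n + 3)%nat by lia.
    replace (2 * S n + 3)%nat with (2 * n + 3 + 2)%nat by lia.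
    rewrite (Cpow_add_r u (2 * n + 3) 2). field. exact H0.
Qed.

Lemma Cmod_odd_geometric_remainder (u : C) (n : nat) :
  Cmod u < 1 ->
  Cmod (u / (1 - u ^ 2) - @sum_n C_AbelianMonoid (fun k => u ^ (2 * k + 1)) n)%C
  <= Cmod u ^ (2 * n + 3) / (1 - Cmod u ^ 2).
Proof.
  intros Hu. rewrite odd_geometric_sum by exact Hu.
  assert (Hp := Cmod_ge_0 u).
  assert (Hpos : 0 < 1 - Cmod u ^ 2) by nra.
  rewrite Cmod_div by now apply one_minus_sqr_neq_0.
  rewrite Cmod_pow. unfold Rdiv. apply Rmult_le_compat_l.
  - now apply pow_le.
  - apply Rinv_le_contravar; [exact Hpos|apply Cmod_one_minus_sqr].
Qed.

(** The sum of two copies of the bound in [Cmod_odd_geometric_remainder]. *)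
Definition remainder_bound (r : R) (n : nat) : R := 2 * (r ^ (2 * n + 3) / (1 - r ^ 2)).

Lemma is_lim_seq_remainder_bound (r : R) :
  0 <= r < 1 -> is_lim_seq (remainder_bound r) 0.
Proof.
  intros Hr.
  apply (is_lim_seq_ext (fun n => 2 * r ^ 3 / (1 - r ^ 2) * (r ^ 2) ^ n)).
  { intros n. unfold remainder_bound. rewrite <- pow_mult, pow_add. field. nra. }
  replace (Finite 0) with (Rbar_mult (2 * r ^ 3 / (1 - r ^ 2)) 0)
    by (simpl; f_equal; ring).
  apply is_lim_seq_scal_l, is_lim_seq_geom.
  rewrite Rabs_pos_eq; nra.
Qed.

(** The common denominator of both kernels is [(1 - u^2) (1 - v^2)], where
    [u = z exp (i pi t)] and [v = z exp (- i pi t)]. *)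
Lemma kernel_denominator (z : C) (t : R) :
  (1 - 2 * z ^ 2 * RtoC (cos (2 * PI * t)) + z ^ 4)%C
  = ((1 - (z * cis (PI * t)) ^ 2) * (1 - (z * cis (- (PI * t))) ^ 2))%C.
Proof.
  assert (H1 := cis_mult_opp (PI * t)).
  assert (H2 : (cis (PI * t) ^ 2 + cis (- (PI * t)) ^ 2)%C = (2 * RtoC (cos (2 * PI * t)))%C).
  { rewrite !cis_pow. simpl INR.
    replace ((1 + 1) * - (PI * t)) with (- (2 * PI * t)) by ring.
    replace ((1 + 1) * (PI * t)) with (2 * PI * t) by ring.
    rewrite cis_plus_opp. apply RtoC_mult. }
  set (u := cis (PI * t)) in *. set (v := cis (- (PI * t))) in *.
  replace ((1 - (z * u) ^ 2) * (1 - (z * v) ^ 2))%C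
    with (1 - z ^ 2 * (u ^ 2 + v ^ 2) + z ^ 4 * (u * v) ^ 2)%C by ring.
  rewrite H1, H2. ring.
Qed.

Lemma Cmod_mult_cis (z : C) (x : R) : Cmod (z * cis x)%C = Cmod z.
Proof. rewrite Cmod_mult, Cmod_cis. ring. Qed.

Lemma freq_mult k t : freq k * t = INR (2 * k + 1) * (PI * t).
Proof. unfold freq. ring. Qed.

(** The two odd geometric series at [u] and [v] are combined with a unimodular
    factor [s]; [s = 1] produces cosines and [s = -1] produces sines. *)
Lemma Cmod_pair_remainder (u v s : C) (n : nat) :
  Cmod u < 1 -> Cmod v = Cmod u -> Cmod s = 1 ->
  Cmod (u / (1 - u ^ 2) + s * (v / (1 - v ^ 2))
     - @sum_n C_AbelianMonoid (fun k => u ^ (2 * k + 1) + s * v ^ (2 * k + 1)) n)%C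
  <= remainder_bound (Cmod u) n.
Proof.
  intros Hu Hv Hs.
  assert (Hsum : @sum_n C_AbelianMonoid
      (fun k => u ^ (2 * k + 1) + s * v ^ (2 * k + 1))%C n
    = (@sum_n C_AbelianMonoid (fun k => u ^ (2 * k + 1))%C n
       + s * @sum_n C_AbelianMonoid (fun k => v ^ (2 * k + 1))%C n)%C).
  { rewrite <- Csum_n_mult_l.
    exact (sum_n_plus (G := C_AbelianMonoid) (fun k => u ^ (2 * k + 1))%C
      (fun k => s * v ^ (2 * k + 1))%C n). }
  rewrite Hsum.
  match goal with |- Cmod (?a + s * ?b - (?p + s * ?q))%C <= _ =>
    replace (a + s * b - (p + s * q))%C with ((a - p) + s * (b - q))%C by ring end.
  eapply Rle_trans; [apply Cmod_triangle|].
  rewrite Cmod_mult, Hs, Rmult_1_l.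
  assert (H1 := Cmod_odd_geometric_remainder u n Hu).
  assert (H2 := Cmod_odd_geometric_remainder v n ltac:(lra)).
  rewrite Hv in H2. unfold remainder_bound. lra.
Qed.

Lemma sin_kernel_remainder (z : C) (hz : Cmod z < 1) (n : nat) (t : R) :
  Cmod (2 * z * (1 + z ^ 2) * RtoC (sin (PI * t)) /
        (1 - 2 * z ^ 2 * RtoC (cos (2 * PI * t)) + z ^ 4)
     - @sum_n C_AbelianMonoid
         (fun k => 2 * z ^ (2 * k + 1) * RtoC (sin (freq k * t))) n)%C
  <= remainder_bound (Cmod z) n.
Proof.
  assert (Hu := Cmod_mult_cis z (PI * t)).
  assert (Hv := Cmod_mult_cis z (- (PI * t))).
  assert (Hu0 := one_minus_sqr_neq_0 (z * cis (PI * t))%C ltac:(lra)).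
  assert (Hv0 := one_minus_sqr_neq_0 (z * cis (- (PI * t)))%C ltac:(lra)).
  assert (Hr := Cmod_pair_remainder (z * cis (PI * t)) (z * cis (- (PI * t))) (RtoC (-1)) n
    ltac:(lra) ltac:(lra) ltac:(rewrite Cmod_R; rewrite Rabs_left; lra)).
  rewrite Hu in Hr.
  assert (Hci : Cmod Ci = 1).
  { unfold Cmod, Ci; simpl. transitivity (sqrt 1); [f_equal; ring|apply sqrt_1]. }
  (* [cis x - cis (- x)] is [Ci] times a real number, and [Ci] has modulus 1. *)
  match goal with |- Cmod ?x <= _ =>
    replace (Cmod x) with (Cmod (Ci * x)) by (rewrite Cmod_mult, Hci; ring) end.
  eapply Rle_trans; [right; apply f_equal|exact Hr].
  match goal with |- (Ci * (?k - ?s))%C = _ =>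
    replace (Ci * (k - s))%C with (Ci * k - Ci * s)%C by ring end.
  rewrite <- Csum_n_mult_l. f_equal.
  - rewrite kernel_denominator.
    assert (H1 := cis_mult_opp (PI * t)).
    assert (H2 := cis_minus_opp (PI * t)). rewrite RtoC_mult in H2.
    set (u := cis (PI * t)) in *. set (v := cis (- (PI * t))) in *.
    assert (Hnum : (Ci * (2 * z * (1 + z ^ 2) * RtoC (sin (PI * t))))%C
        = ((z * u - z * v) * (1 + (z * u) * (z * v)))%C).
    { replace ((z * u) * (z * v))%C with (z ^ 2 * (u * v))%C by ring.
      replace (z * u - z * v)%C with (z * (u - v))%C by ring.
      rewrite H1, H2. ring. }
    match goal with |- (Ci * (?a / ?b))%C = _ =>
      replace (Ci * (a / b))%C with ((Ci * a) / b)%C by (unfold Cdiv; ring) end.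
    rewrite Hnum. field. split; assumption.
  - apply (sum_n_ext (G := C_AbelianMonoid)). intros k.
    match goal with |- ?x = ?y => change (@eq C x y) end.
    rewrite !Cpow_mult_l, !cis_pow.
    replace (INR (2 * k + 1) * - (PI * t)) with (- (INR (2 * k + 1) * (PI * t))) by ring.
    rewrite freq_mult.
    assert (H2 := cis_minus_opp (INR (2 * k + 1) * (PI * t))).
    rewrite RtoC_mult in H2.
    match goal with |- _ = (?x * ?a + _ * (?x * ?b))%C =>
      transitivity (x * (a - b))%C; [rewrite H2|]; ring end.
Qed.

Lemma cos_kernel_remainder (z : C) (hz : Cmod z < 1) (n : nat) (t : R) :
  Cmod (2 * z * (1 - z ^ 2) * RtoC (cos (PI * t)) /
        (1 - 2 * z ^ 2 * RtoC (cos (2 * PI * t)) + z ^ 4)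
     - @sum_n C_AbelianMonoid
         (fun k => 2 * z ^ (2 * k + 1) * RtoC (cos (freq k * t))) n)%C
  <= remainder_bound (Cmod z) n.
Proof.
  assert (Hu := Cmod_mult_cis z (PI * t)).
  assert (Hv := Cmod_mult_cis z (- (PI * t))).
  assert (Hu0 := one_minus_sqr_neq_0 (z * cis (PI * t))%C ltac:(lra)).
  assert (Hv0 := one_minus_sqr_neq_0 (z * cis (- (PI * t)))%C ltac:(lra)).
  assert (Hr := Cmod_pair_remainder (z * cis (PI * t)) (z * cis (- (PI * t))) (RtoC 1) n
    ltac:(lra) ltac:(lra) ltac:(rewrite Cmod_R; apply Rabs_R1)).
  rewrite Hu in Hr.
  eapply Rle_trans; [right; apply f_equal|exact Hr].
  f_equal.
  - rewrite kernel_denominator.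
    assert (H1 := cis_mult_opp (PI * t)).
    assert (H2 := cis_plus_opp (PI * t)). rewrite RtoC_mult in H2.
    set (u := cis (PI * t)) in *. set (v := cis (- (PI * t))) in *.
    assert (Hnum : ((2 * z * (1 - z ^ 2) * RtoC (cos (PI * t))))%C
        = ((z * u + z * v) * (1 - (z * u) * (z * v)))%C).
    { replace ((z * u) * (z * v))%C with (z ^ 2 * (u * v))%C by ring.
      replace (z * u + z * v)%C with (z * (u + v))%C by ring.
      rewrite H1, H2. ring. }
    rewrite Hnum. field. split; assumption.
  - apply (sum_n_ext (G := C_AbelianMonoid)). intros k.
    match goal with |- ?x = ?y => change (@eq C x y) end.
    rewrite !Cpow_mult_l, !cis_pow.
    replace (INR (2 * k + 1) * - (PI * t)) with (- (INR (2 * k + 1) * (PI * t))) by ring.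
    rewrite freq_mult.
    assert (H2 := cis_plus_opp (INR (2 * k + 1) * (PI * t))).
    rewrite RtoC_mult in H2.
    match goal with |- _ = (?x * ?a + _ * (?x * ?b))%C =>
      transitivity (x * (a + b))%C; [rewrite H2|]; ring end.
Qed.

(** * The integral representation *)

(** At an integer [s >= 0] the complex powers [(2k+1)^s] are ordinary powers, and
    uniqueness of sums lets any sum of the series be taken as the value. *)
Lemma legendre_chi_nat_eq (s : nat) (z v : C) :
  @is_series C_AbsRing C_NormedModule
    (fun k => z ^ (2 * k + 1) * RtoC (/ INR (2 * k + 1) ^ s))%C v ->
  legendre_chi (RtoC (INR s)) z = v.
Proof.
  intros H.
  assert (H' : @is_series C_AbsRing C_NormedModule
    (fun k => z ^ (2 * k + 1) / cexp (RtoC (INR s) * RtoC (ln (INR (2 * k + 1)))))%C v).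
  { eapply is_series_ext; [|exact H]. intros k.
    assert (Hk : 0 < INR (2 * k + 1)) by (apply lt_0_INR; lia).
    rewrite <- RtoC_mult, cexp_RtoC. change (exp (INR s * ln (INR (2 * k + 1))))
      with (Rpower (INR (2 * k + 1)) (INR s)).
    rewrite Rpower_pow by exact Hk.
    rewrite RtoC_inv by (apply pow_nonzero; lra). reflexivity. }
  unfold legendre_chi. apply (iota_unique (V := C_CompleteNormedModule)); [|exact H'].
  intros y Hy.
  exact (filterlim_locally_unique (V := C_NormedModule) _ _ _ Hy H').
Qed.

Lemma euler_eq_taylor_coeff (E : nat -> R -> R) (m : nat) (t : R) :
  E m t = INR (fact m) * taylor_coeff E m t.
Proof. unfold taylor_coeff. field. apply INR_fact_neq_0. Qed.

Lemma continuous_euler (E : nat -> R -> R) (hE : is_euler_polynomials E) m t :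
  continuous (E m) t.
Proof.
  apply (continuous_ext (fun t => INR (fact m) * taylor_coeff E m t)).
  { intros y. symmetry. apply euler_eq_taylor_coeff. }
  apply (continuous_scal_r (INR (fact m)) (taylor_coeff E m)).
  now apply continuous_taylor_coeff.
Qed.

(** Common part of both formulas: the harmonics [w k], the kernel [F] that they
    expand, and the moments [l / freq k ^ s] of [E m / m!] against them.  The last
    hypothesis says that [A] normalises [l] so that the [k]-th term becomes
    [z^(2k+1) / (2k+1)^s]. *)
Lemma legendre_chi_integral (E : nat -> R -> R) (hE : is_euler_polynomials E)
    (delta : R) (z : C) (m s : nat) (A l : R) (w : nat -> R -> R) (F : R -> C) :
  0 <= delta -> Cmod z < 1 ->
  (forall k, is_RInt (fun t => taylor_coeff E m t * w k t) 0 delta (l / freq k ^ s)) ->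
  (forall n t,
    Cmod (F t - @sum_n C_AbelianMonoid
                  (fun k => 2 * z ^ (2 * k + 1) * RtoC (w k t)) n)%C
    <= remainder_bound (Cmod z) n) ->
  A * (INR (fact m) * (2 * l)) = PI ^ s ->
  legendre_chi (RtoC (INR s)) z =
    (RtoC A * @RInt C_R_CompleteNormedModule (fun t => RtoC (E m t) * F t) 0 delta)%C.
Proof.
  intros Hd Hz Hl HF HA. apply legendre_chi_nat_eq.
  assert (Hs := is_series_RInt (E m) delta (fun k => 2 * z ^ (2 * k + 1))%C w
    (fun k => INR (fact m) * (l / freq k ^ s)) F (remainder_bound (Cmod z)) Hd
    (continuous_euler E hE m)).
  assert (H := Hs
    (fun k => is_RInt_ext _ _ _ _ _ (fun t _ => eq_sym (eq_trans
       (f_equal (fun x => x * w k t) (euler_eq_taylor_coeff E m t)) (Rmult_assoc _ _ _)))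
      (is_RInt_scal _ _ _ (INR (fact m)) _ (Hl k))) HF
    (is_lim_seq_remainder_bound _ (conj (Cmod_ge_0 z) Hz))).
  generalize (is_series_scal_l (V := C_NormedModule) (RtoC A) _ _ H).
  apply is_series_ext. intros k.
  match goal with |- ?x = ?y => change (@eq C x y) end.
  change (@scal C_AbsRing C_NormedModule) with Cmult.
  assert (HPI := pow_nonzero _ s PI_neq0).
  assert (Hk : INR (2 * k + 1) ^ s <> 0) by (apply pow_nonzero, not_0_INR; lia).
  replace (/ INR (2 * k + 1) ^ s) with (A * 2 * (INR (fact m) * (l / freq k ^ s))).
  - rewrite !RtoC_mult. ring.
  - unfold freq. rewrite Rpow_mult_distr.
    replace (A * 2 * (INR (fact m) * (l / (INR (2 * k + 1) ^ s * PI ^ s))))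
      with (A * (INR (fact m) * (2 * l)) / (INR (2 * k + 1) ^ s * PI ^ s))
      by (field; split; assumption).
    rewrite HA. field. split; assumption.
Qed.

Theorem theorem2 (E : nat -> R -> R) (hE : is_euler_polynomials E)
    (delta : R) (hdelta : delta = 1%R \/ delta = (1 / 2)%R)
    (n : nat) (hn : (0 < n)%nat)
    (z : C) (hz : (Cmod z < 1)%R) :
  legendre_chi (RtoC (INR (2 * n + 1))) z =
    (RtoC ((-1) ^ n * (1 / delta) *
           (PI ^ (2 * n + 1) / (4 * INR (fact (2 * n))))) *
     @RInt C_R_CompleteNormedModule
       (fun t : R =>
          RtoC (E (2 * n)%nat t) *
          (2 * z * (1 + z ^ 2) * RtoC (sin (PI * t)) /
           (1 - 2 * z ^ 2 * RtoC (cos (2 * PI * t)) + z ^ 4)))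
       0 delta)%C
  /\
  legendre_chi (RtoC (INR (2 * n))) z =
    (RtoC ((-1) ^ n * (1 / delta) *
           (PI ^ (2 * n) / (4 * INR (fact (2 * n - 1))))) *
     @RInt C_R_CompleteNormedModule
       (fun t : R =>
          RtoC (E (2 * n - 1)%nat t) *
          (2 * z * (1 - z ^ 2) * RtoC (cos (PI * t)) /
           (1 - 2 * z ^ 2 * RtoC (cos (2 * PI * t)) + z ^ 4)))
       0 delta)%C.
Proof.
  destruct (Nat.lt_exists_pred 0 n hn) as [m [Hm _]].
  assert (Hm1 : (2 * n - 1 = 2 * m + 1)%nat) by lia.
  assert (Hm2 : (2 * n = 2 * m + 2)%nat) by lia.
  assert (Hd : 0 < delta) by (destruct hdelta as [->| ->]; lra).
  assert (Hsign : (-1) ^ n * (-1) ^ n = 1)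
    by (rewrite <- Rpow_mult_distr; replace (-1 * -1) with 1 by ring; apply pow1).
  assert (Hconst : forall p f, f <> 0 ->
    (-1) ^ n * (1 / delta) * (p / (4 * f)) * (f * (2 * ((-1) ^ n * (2 * delta)))) = p).
  { intros p f Hf.
    replace p with ((-1) ^ n * (-1) ^ n * p) at 2 by (rewrite Hsign; ring).
    field. split; lra. }
  split.
  - apply (legendre_chi_integral E hE delta z (2 * n) (2 * n + 1) _
      ((-1) ^ n * (2 * delta)) (fun k t => sin (freq k * t))); try assumption.
    + lra.
    + intros k. exact (proj1 (is_RInt_taylor_coeff_trig E hE delta k n hdelta)).
    + intros N t. now apply sin_kernel_remainder.
    + apply Hconst, INR_fact_neq_0.
  - apply (legendre_chi_integral E hE delta z (2 * n - 1) (2 * n) _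
      ((-1) ^ n * (2 * delta)) (fun k t => cos (freq k * t))); try assumption.
    + lra.
    + intros k. rewrite Hm1, Hm2, Hm.
      exact (proj2 (is_RInt_taylor_coeff_trig E hE delta k m hdelta)).
    + intros N t. now apply cos_kernel_remainder.
    + apply Hconst, INR_fact_neq_0.
Qed.
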